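(* For $\alpha>0$ and $n\ge 1$ let $\widehat{x}_{n,k}^{(\alpha)}$, $k=1,\ldots,n$, be the zeros of the $X_1$-Laguerre polynomial $\widehat{L}_n^{(\alpha)}(x)$ arranged in increasing order, so that the regular zeros are those with $k=2,\ldots,n$. Then, for every $n\ge 2$, each regular zero $\widehat{x}_{n,k}^{(\alpha)}$, $k=2,\ldots,n$, is an increasing function of $\alpha\in(0,\infty)$. Moreover, for every $\alpha>0$ and $n\ge2$, the regular zeros of the polynomials of consecutive degrees $n$ and $n+1$ interlace: $$0<\widehat{x}_{n+1,2}^{(\alpha)}<\widehat{x}_{n,2}^{(\alpha)}<\widehat{x}_{n+1,3}^{(\alpha)}<\ldots<\widehat{x}_{n+1,n}^{(\alpha)}<\widehat{x}_{n,n}^{(\alpha)}<\widehat{x}_{n+1,n+1}^{(\alpha)}.$$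
   Context: For $\alpha>0$, the sequence of $X_1$-Laguerre polynomials $\{\widehat{L}_n^{(\alpha)}(x)\}_{n=1}^\infty$ (with $\deg\widehat{L}_n^{(\alpha)}=n$) is obtained by Gram-Schmidt orthogonalization of the polynomials $x+\alpha+1,\ (x+\alpha)^2,\ (x+\alpha)^3,\ldots$ with respect to the inner product $$\langle P,Q\rangle_\alpha=\int_0^\infty P(x)Q(x)\frac{e^{-x}x^\alpha}{(x+\alpha)^2}\,dx.$$ The normalization (nonzero constant factors) is irrelevant for the zeros. It is known that $\widehat{L}_n^{(\alpha)}$ has $n-1$ distinct zeros in $(0,\infty)$, called the regular zeros, and one further real zero in $(-\infty,-\alpha)$, called the exceptional zero; thus, in increasing order, $\widehat{x}_{n,1}^{(\alpha)}$ is the exceptional zero and $\widehat{x}_{n,k}^{(\alpha)}$, $k=2,\ldots,n$, are the regular zeros. *)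

(* Defs.v *)
From HB Require Import structures.
From mathcomp Require Import all_boot all_order all_algebra.
From mathcomp Require Import polyrcf.
From mathcomp Require Import all_classical all_reals all_analysis.

Set Implicit Arguments.
Unset Strict Implicit.
Unset Printing Implicit Defensive.

Import Order.TTheory GRing.Theory Num.Theory.
Import numFieldNormedType.Exports.

Local Open Scope ring_scope.

(* Families of polynomials and zeros are numbered from 1; the value at index 0
   has no meaning. *)

(* [:: p_1; ...; p_n], the Gram-Schmidt orthogonalization (without
   normalization) of e 1, ..., e n with respect to ip. *)
Fixpoint gram_schmidt (R : realType) (ip : {poly R} -> {poly R} -> R)
    (e : nat -> {poly R}) (n : nat) : seq {poly R} :=
  if n is m.+1 then
    let s := gram_schmidt ip e m in
    rcons s (e n - \sum_(p <- s) (ip (e n) p / ip p p) *: p)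
  else [::].

Definition X1_weight (R : realType) (a x : R) : R :=
  expR (- x) * x `^ a / (x + a) ^+ 2.

Definition X1_inner (R : realType) (a : R) (p q : {poly R}) : R :=
  \int[lebesgue_measure]_(x in [set x : R | 0 < x])
    (p.[x] * q.[x] * X1_weight a x).

Definition X1_basis (R : realType) (a : R) (n : nat) : {poly R} :=
  if n == 1%N then 'X + (a + 1)%:P else ('X + a%:P) ^+ n.

(* The exceptional X_1-Laguerre polynomial of degree n, in its monic
   normalization. *)
Definition X1_Laguerre (R : realType) (a : R) (n : nat) : {poly R} :=
  last 0 (gram_schmidt (X1_inner a) (X1_basis a) n).

(* The k-th smallest real zero, k >= 1. rootsR is the strictly increasing list
   of all the real roots; the value is 0 when there are fewer than k of them,
   and in particular a positive value is always a genuine zero. *)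
Definition X1_zero (R : realType) (a : R) (n k : nat) : R :=
  nth 0 (rootsR (X1_Laguerre a n)) k.-1.

(* Main.v *)
Require Import Defs.
From mathcomp Require Import all_boot all_order all_algebra.
From mathcomp Require Import polyrcf.
From mathcomp Require Import all_classical all_reals all_analysis.
From mathcomp Require Import measurable_realfun.
From mathcomp Require Import ring lra zify.
Set Implicit Arguments.
Unset Strict Implicit.
Unset Printing Implicit Defensive.
Import Order.TTheory GRing.Theory Num.Theory.
Import numFieldNormedType.Exports.
Local Open Scope ring_scope.

(* With q = L_{n-1}^(a-1), the X_1-Laguerre polynomial of degree n is, up to a
   constant, P = (x + a + 1) q - (x + a) q' = - (x + a)^2 e^x (e^(-x) q / (x + a))',
   so that its regular zeros are the positive critical points of
   e^(-x) q / (x + a). If z_1 < ... < z_{n-1} are the zeros of q, they are the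
   solutions of
     sum_j 1 / (x - z_j) = 1 + 1 / (x + a),
   one in each interval (z_j, z_{j+1}) and one beyond z_{n-1}; the difference of
   the two sides decreases on these intervals. Comparing this equation termwise
   for two values of a, or for two consecutive degrees, reduces both claims to
   the corresponding facts on Laguerre zeros. Interlacing comes from
   L_{m+1} ~ (x - (m + a)) L_m - x L_m'. Monotonicity comes from Stieltjes'
   relations sum_{j != i} 2 / (z_i - z_j) + a / z_i = 1, read at the index where
   z_i(b) - z_i(a) is smallest.

   P is identified with the output of Gram-Schmidt through its differential
   equation, which makes P_m P_n times the weight an exact derivative. *)

(** * Derivatives of products of linear factors *)

Section LogDerivative.
Variable F : fieldType.
Implicit Types (x : F) (n : nat).

Lemma horner_prod_XsubC (I : finType) (P : pred I) (z : I -> F) x :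
  (\prod_(j | P j) ('X - (z j)%:P)).[x] = \prod_(j | P j) (x - z j).
Proof.
by rewrite horner_prod; apply: eq_bigr => j _; rewrite hornerXsubC.
Qed.

Lemma deriv_prod_XsubC (I : finType) (P : pred I) (z : I -> F) x :
    (forall j, P j -> x != z j) ->
  ((\prod_(j | P j) ('X - (z j)%:P))^`()).[x] =
  \prod_(j | P j) (x - z j) * \sum_(j | P j) (x - z j)^-1.
Proof.
move=> xz; rewrite -big_filter -[in X in _ * X]big_filter -[in X in X * _]big_filter.
have: all P [seq i <- index_enum I | P i] by apply: filter_all.
elim: [seq i <- index_enum I | P i] => [|j s ih] /=.
  by rewrite !big_nil derivC horner0 mulr0.
move=> /andP[Pj /ih {}ih]; rewrite !big_cons derivM hornerD !hornerM ih.
rewrite derivXsubC hornerC hornerXsubC horner_prod.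
under eq_bigr do rewrite hornerXsubC.
have := xz j Pj; rewrite -subr_eq0 => ne.
by field.
Qed.

Lemma deriv_prod_XsubC_root n (z : nat -> F) (i : 'I_n) :
  ((\prod_(j < n) ('X - (z j)%:P))^`()).[z i] =
  \prod_(j < n | j != i) (z i - z j).
Proof.
rewrite (bigD1 i) //= derivM derivXsubC mul1r hornerD hornerM hornerXsubC.
by rewrite subrr mul0r addr0 horner_prod_XsubC.
Qed.

(** Writing the product as [p = (x - z_i) r] gives [p'(z_i) = r(z_i)] and [p''(z_i) = 2 r'(z_i)];
    the sum is the logarithmic derivative of [r]. *)
Lemma deriv2_prod_XsubC_root n (z : nat -> F) (i : 'I_n) :
    (forall j : 'I_n, j != i -> z i != z j) ->
  ((\prod_(j < n) ('X - (z j)%:P))^`()^`()).[z i] =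
  ((\prod_(j < n) ('X - (z j)%:P))^`()).[z i] *
    (2%:R * \sum_(j < n | j != i) (z i - z j)^-1).
Proof.
move=> zne; rewrite deriv_prod_XsubC_root (bigD1 i) //= derivM derivXsubC mul1r.
rewrite derivD derivM derivXsubC mul1r !hornerD hornerM hornerXsubC subrr mul0r.
by rewrite addr0 (deriv_prod_XsubC zne); ring.
Qed.

End LogDerivative.

(** * Sign bookkeeping for products of differences *)

Section Signs.
Variable R : realDomainType.
Implicit Types (x u v : R) (k n : nat).

(** Turns alternating signs into the negative products required by the intermediate value
    theorem. *)
Lemma mulr_lt0_signS k u v :
  0 < (-1) ^+ k.+1 * u -> 0 < (-1) ^+ k * v -> u * v < 0.
Proof.
rewrite -signr_odd -[(-1) ^+ k]signr_odd oddS; case: odd;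
  rewrite /= expr0 expr1 ?mul1r ?mulN1r;
  rewrite ?oppr_gt0; first by move=> *; rewrite pmulr_rlt0.
by move=> *; rewrite nmulr_rlt0.
Qed.

(** Each index from [i] on contributes one negative factor. The predicate [P] allows a factor to be
    left out, as happens for a derivative at a root. *)
Lemma sign_prod_subr (P : pred nat) n (z : nat -> R) i x :
    (forall j, (j < n)%N -> (j < i)%N -> P j -> z j < x) ->
    (forall j, (j < n)%N -> (i <= j)%N -> P j -> x < z j) ->
  0 < (-1) ^+ (\sum_(j < n | P j) (i <= j)%N) * \prod_(j < n | P j) (x - z j).
Proof.
move=> lo hi; rewrite -prodrXr -big_split; apply: prodr_gt0 => j Pj /=.
case: leqP => ij; rewrite ?expr1 ?expr0 ?mulN1r ?mul1r ?oppr_gt0 ?subr_lt0 ?subr_gt0.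
  exact: hi.
exact: lo.
Qed.

Lemma sum_nat_leq n i : (\sum_(j < n) (i <= j) = n - i)%N.
Proof.
by elim: n => [|n ih]; rewrite ?big_ord0 // big_ord_recr /= ih; lia.
Qed.

End Signs.

(** * Locating all roots of a real polynomial *)

Section RealRoots.
Variable R : rcfType.
Implicit Types (p : {poly R}) (n : nat).

Lemma monic_pinfty p b : p \is monic -> exists2 M, b < M & 0 < p.[M].
Proof.
move=> pm; have [|N hN] := @poly_pinfty_gt_lc _ p; first by rewrite (monicP pm).
exists (Num.max N (b + 1)); first by rewrite lt_max ltrDl ltr01 orbT.
apply: lt_le_trans (hN _ _); first by rewrite (monicP pm).
by rewrite le_max lexx.
Qed.

(** The reflection [x -> - x] reduces this to the behaviour at plus infinity; the sign makes the
    reflected polynomial monic. *)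
Lemma monic_minfty p b : p \is monic ->
  exists2 M, M < b & 0 < (-1) ^+ (size p).-1 * p.[M].
Proof.
move=> pm; pose q := (-1) ^+ (size p).-1 *: (p \Po - 'X).
have [|M bM] := @monic_pinfty q (- b).
  rewrite monicE lead_coefZ lead_coef_comp ?size_polyN ?size_polyX //.
  by rewrite lead_coefN lead_coefX (monicP pm) mul1r -expr2 sqrr_sign.
rewrite /q hornerZ horner_comp !hornerE => pM; exists (- M) => //.
by rewrite ltrNl.
Qed.

Lemma rootsR_nth_lt p i j :
  (i < j < size (rootsR p))%N -> nth 0 (rootsR p) i < nth 0 (rootsR p) j.
Proof.
move=> /andP[ij js]; apply: (sorted_ltn_nth lt_trans) => //.
- exact: sorted_roots.
- by rewrite inE (ltn_trans ij).
Qed.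

Lemma mem_rootsR p x : p != 0 -> (x \in rootsR p) = root p x.
Proof. by move=> p0; rewrite -(roots_on_rootsR p0) in_itv. Qed.

Lemma root_nth_rootsR p i : p != 0 -> (i < size (rootsR p))%N ->
  root p (nth 0 (rootsR p) i).
Proof. by move=> p0 /(mem_nth 0); rewrite mem_rootsR. Qed.

Lemma uniq_rootsR p : poly.uniq_roots (rootsR p).
Proof. by rewrite uniq_rootsE uniq_roots. Qed.

Lemma monic_prod_rootsR p n : p \is monic -> size p = n.+1 ->
    size (rootsR p) = n ->
  p = \prod_(i < n) ('X - (nth 0 (rootsR p) i)%:P).
Proof.
move=> pm sp sr; have p0 := monic_neq0 pm.
rewrite [LHS](@all_roots_prod_XsubC _ p (rootsR p)) ?sr ?uniq_rootsR //.
  by rewrite (monicP pm) scale1r (big_nth 0) big_mkord sr.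
by apply/allP => x; rewrite mem_rootsR.
Qed.

(** Each of the [n] disjoint intervals contains a root, and the degree leaves room for no other; as
    the intervals are ordered, so are these roots. *)
Lemma rootsR_sign_changes p n (l r : nat -> R) :
    size p = n.+1 ->
    (forall i, (i < n)%N -> l i < r i) ->
    (forall i, (i < n)%N -> p.[l i] * p.[r i] < 0) ->
    (forall i, (i.+1 < n)%N -> r i <= l i.+1) ->
  size (rootsR p) = n /\ forall i, (i < n)%N -> l i < nth 0 (rootsR p) i < r i.
Proof.
move=> sp lr ch rl.
(* The bound on [i] sits inside the existential, with default 0, so that the chosen roots form a
   total function on [nat]. *)
have zP i : {x | (i < n)%N -> (l i < x < r i) && root p x}.
  case: (ltnP i n) => [ltin|_]; last by exists 0.
  have [x xlr px] := poly_ivtoo (ltW (lr i ltin)) (ch i ltin).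
  by exists x => _; rewrite px andbT; rewrite in_itv /= in xlr.
pose z i := sval (zP i).
have zb i : (i < n)%N -> l i < z i < r i.
  by rewrite /z; case: (zP i) => x /= h /h /andP[].
have zr i : (i < n)%N -> root p (z i).
  by rewrite /z; case: (zP i) => x /= h /h /andP[].
have zs : sorted <%R (mkseq z n).
  apply/(sortedP 0) => i; rewrite size_mkseq => ltin.
  rewrite !nth_mkseq // 1?ltnW //.
  have /andP[_ h1] := zb i (ltnW ltin); have /andP[h2 _] := zb _ ltin.
  exact: lt_trans h1 (le_lt_trans (rl _ ltin) h2).
have p0 : p != 0 by rewrite -size_poly_gt0 sp.
have zall : all (root p) (mkseq z n).
  by apply/allP => x /mapP[i]; rewrite mem_iota /= add0n => /zr ? ->.
suff -> : rootsR p = mkseq z n.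
  by rewrite size_mkseq; split=> // i ltin; rewrite nth_mkseq // zb.
apply: lt_sorted_eq => //; first exact: sorted_roots.
move=> x; rewrite mem_rootsR //.
rewrite [in LHS](@all_roots_prod_XsubC _ p (mkseq z n)) //; last 2 first.
- by rewrite size_mkseq.
- by rewrite uniq_rootsE lt_sorted_uniq.
by rewrite rootZ ?lead_coef_eq0 // root_prod_XsubC.
Qed.

Lemma sign_horner_rootsR p n i x :
    p \is monic -> size p = n.+1 -> size (rootsR p) = n ->
    (forall j, (j < n)%N -> (j < i)%N -> nth 0 (rootsR p) j < x) ->
    (forall j, (j < n)%N -> (i <= j)%N -> x < nth 0 (rootsR p) j) ->
  0 < (-1) ^+ (n - i) * p.[x].
Proof.
move=> pm sp sr lo hi; rewrite (monic_prod_rootsR pm sp sr) horner_prod_XsubC.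
rewrite -(sum_nat_leq n i); apply: (@sign_prod_subr _ xpredT) => j ??; auto.
Qed.

(** At a root, the derivative is the product of the differences to the other roots, and the
    [n - i.+1] larger roots give the negative factors. *)
Lemma sign_deriv_rootsR p n i :
    p \is monic -> size p = n.+1 -> size (rootsR p) = n -> (i < n)%N ->
  0 < (-1) ^+ (n - i.+1) * p^`().[nth 0 (rootsR p) i].
Proof.
move=> pm sp sr ltin.
rewrite [in p^`()](monic_prod_rootsR pm sp sr).
rewrite (deriv_prod_XsubC_root (nth 0 (rootsR p)) (Ordinal ltin)) /=.
have -> : (n - i.+1 = \sum_(j < n | j != i :> nat) (i.+1 <= j))%N.
  by rewrite -(sum_nat_leq n i.+1) (bigD1 (Ordinal ltin)) //= ltnn.
apply: (@sign_prod_subr _ (fun j => j != i) n (nth 0 (rootsR p)) i.+1).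
- by move=> j jn; rewrite ltnS leq_eqVlt => /orP[->//|ji] _;
  rewrite rootsR_nth_lt // ji sr.
- by move=> j jn ij _; rewrite rootsR_nth_lt // ij sr.
Qed.

End RealRoots.

(** * Laguerre zeros: reality, interlacing, monotonicity in the parameter *)

Section Laguerre.
Variable R : rcfType.
Implicit Types (a b x : R) (m n i j : nat).

(* [(-1)^m m! L_m^(a - 1)], the shift making [0 < a] the classical range. *)
Fixpoint laguerre a m : {poly R} :=
  if m is n.+1 then
    ('X - (n%:R + a)%:P) * laguerre a n - 'X * (laguerre a n)^`()
  else 1.

Definition laguerre_zero a m i : R := nth 0 (rootsR (laguerre a m)) i.

Lemma laguerre_ode a m (q := laguerre a m) :
  'X * q^`()^`() + (a%:P - 'X) * q^`() + m%:R%:P * q = 0.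
Proof.
rewrite {}/q; elim: m => [|m ih] /=.
  by rewrite derivC linear0 !mulr0 mul0r !addr0.
set q := laguerre a m in ih *; set r := _ - 'X * _.
(* The equation for [q] eliminates [q''] from the derivative of the recursion. *)
have dr : r^`() = m.+1%:R%:P * (q - q^`()).
  rewrite /r derivB !derivM derivXsubC derivX -natr1 !polyCD polyC1.
  by move: ih => /eqP; rewrite -addrA addr_eq0 => /eqP ih; ring: ih.
rewrite dr derivM derivC mul0r add0r derivB /r -natr1 !polyCD polyC1.
by move: ih => /eqP; rewrite -addrA addr_eq0 => /eqP ih; ring: ih.
Qed.

Lemma size_monic_laguerre a m :
  laguerre a m \is monic /\ size (laguerre a m) = m.+1.
Proof.
elim: m => [|m [mon sz]] /=; first by rewrite monic1 size_poly1.
set q := laguerre a m in mon sz *.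
have sXq : size ('X * q) = m.+2 by rewrite mulrC size_mulX ?monic_neq0 // sz.
have -> : ('X - (m%:R + a)%:P) * q - 'X * q^`() =
    'X * q + - ((m%:R + a)%:P * q + 'X * q^`()) by ring.
have lt : (size (- ((m%:R + a)%:P * q + 'X * q^`()))%R < size ('X * q)%R)%N.
  rewrite size_polyN sXq ltnS (leq_trans (size_polyD _ _)) // geq_max.
  rewrite mul_polyC (leq_trans (size_scale_leq _ _)) ?sz //=.
  rewrite mulrC (leq_trans (size_polyMleq _ _)) // size_polyX addn2 /=.
  by rewrite -sz lt_size_deriv ?monic_neq0.
rewrite size_polyDl // sXq; split=> //.
by rewrite monicE lead_coefDl // lead_coefM lead_coefX mul1r (monicP mon).
Qed.

Lemma monic_laguerre a m : laguerre a m \is monic.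
Proof. by have [] := size_monic_laguerre a m. Qed.

Lemma size_laguerre a m : size (laguerre a m) = m.+1.
Proof. by have [] := size_monic_laguerre a m. Qed.

Lemma laguerre_neq0 a m : laguerre a m != 0.
Proof. exact/monic_neq0/monic_laguerre. Qed.

(** The recursion reduces to [- z q'(z)] at a zero [z] of [q = laguerre a m], and to
    [- (m + a) q(0)] at 0. Hence the next polynomial alternates in sign along 0, the zeros of [q],
    and a far point [M], which gives its [m.+1] zeros and the interlacing at once. *)
Lemma laguerre_zero_step a m : 0 < a ->
    size (rootsR (laguerre a m)) = m ->
    (forall i, (i < m)%N -> 0 < laguerre_zero a m i) ->
  size (rootsR (laguerre a m.+1)) = m.+1 /\
  forall i, (i < m.+1)%N ->
    [/\ 0 < laguerre_zero a m.+1 i,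
        (0 < i)%N -> laguerre_zero a m i.-1 < laguerre_zero a m.+1 i &
        (i < m)%N -> laguerre_zero a m.+1 i < laguerre_zero a m i].
Proof.
move=> a0 sr pos; rewrite /laguerre_zero in pos *.
have mon := monic_laguerre a m; have sz := size_laguerre a m.
set q := laguerre a m in sr pos mon sz *; set p := laguerre a m.+1.
pose t i := if i is j.+1 then nth 0 (rootsR q) j else 0.
have [M tM pM] := monic_pinfty (t m) (monic_laguerre a m.+1).
pose u i := if (i <= m)%N then t i else M.
have us i : (i < m.+1)%N -> u i < u i.+1.
  rewrite ltnS /u => im; rewrite im; case: ltnP => [im'|mi].
    case: i im im' => [|i] _ im'; first exact: pos.
    by rewrite rootsR_nth_lt // ltnSn sr.
  by have -> : i = m by apply/eqP; rewrite eqn_leq im mi.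
have sg i : (i <= m.+1)%N -> 0 < (-1) ^+ (m.+1 - i) * p.[u i].
  rewrite /u leq_eqVlt => /orP[/eqP ->|].
    by rewrite ltnn subnn mul1r.
  rewrite ltnS => im; rewrite im /p /= -/q.
  case: i im => [_|i im] /=.
    have := @sign_horner_rootsR _ q m 0 0 mon sz sr.
    rewrite !subn0 exprS => /(_ (fun _ _ => ltac:(done)) (fun j jm _ => pos j jm)).
    have ma : 0 < m%:R + a by rewrite ltr_wpDl.
    move=> /(mulr_gt0 ma); congr (_ < _).
    rewrite !(hornerD, hornerM, hornerN, hornerC, hornerX); ring.
  rewrite subSS !(hornerD, hornerM, hornerN, hornerC, hornerX).
  have /rootP -> : root q (nth 0 (rootsR q) i) by rewrite root_nth_rootsR
    ?laguerre_neq0 ?sr.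
  have := mulr_gt0 (pos i im) (sign_deriv_rootsR mon sz sr im).
  rewrite -[(m - i)%N](@subnSK i m) // exprS; congr (_ < _); ring.
have [||-> h] := @rootsR_sign_changes _ p m.+1 u (fun i =>
  u i.+1) (size_laguerre a m.+1) us.
- move=> i im; apply: (@mulr_lt0_signS _ (m - i)).
    by rewrite -subSn //; apply: sg; exact: ltnW.
  by rewrite -subSS; apply: sg.
- by move=> *; exact: lexx.
split=> // i im; have /andP[h1 h2] := h i im.
split.
- apply: le_lt_trans h1; rewrite /u -ltnS im; case: i im {h2} => //= i im.
  by rewrite ltW ?pos.
- by move=> i0; move: h1; rewrite /u -ltnS im; case: i i0 im {h2}.
- by move=> im'; move: h2; rewrite /u im'.
Qed.

Lemma laguerre_zeros a m : 0 < a ->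
  size (rootsR (laguerre a m)) = m /\
  forall i, (i < m)%N -> 0 < laguerre_zero a m i.
Proof.
move=> a0; elim: m => [|m [sr pos]].
  by rewrite /= -polyC1 rootsRC.
have [? h] := laguerre_zero_step a0 sr pos.
by split=> // i /h[].
Qed.

Lemma size_rootsR_laguerre a m : 0 < a -> size (rootsR (laguerre a m)) = m.
Proof. by move=> a0; have [] := laguerre_zeros m a0. Qed.

Lemma laguerre_zero_gt0 a m i : 0 < a -> (i < m)%N -> 0 < laguerre_zero a m i.
Proof. by move=> a0; have [_] := laguerre_zeros m a0; apply. Qed.

Lemma laguerre_zero_lt a m i j : 0 < a -> (i < j < m)%N ->
  laguerre_zero a m i < laguerre_zero a m j.
Proof. by move=> a0 h; rewrite rootsR_nth_lt // size_rootsR_laguerre. Qed.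

Lemma laguerre_zero_interlace a m i : 0 < a -> (i < m)%N ->
  laguerre_zero a m.+1 i < laguerre_zero a m i < laguerre_zero a m.+1 i.+1.
Proof.
move=> a0 im; have [sr pos] := laguerre_zeros m a0.
have [_ h] := laguerre_zero_step a0 sr pos.
have [_ _ ->//] := h i (ltnW im); have [_ ->//] := h i.+1 im.
Qed.

Lemma laguerre_prod a m : 0 < a ->
  laguerre a m = \prod_(i < m) ('X - (laguerre_zero a m i)%:P).
Proof.
move=> a0; apply: monic_prod_rootsR; first exact: monic_laguerre.
  exact: size_laguerre.
exact: size_rootsR_laguerre.
Qed.

(* Stieltjes' electrostatic equilibrium: this is the differential equation at a
   zero. *)
Lemma laguerre_zero_equilibrium a m (i : 'I_m) (z := laguerre_zero a m) :
  0 < a -> 2%:R * \sum_(j < m | j != i) (z i - z j)^-1 + a / z i = 1.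
Proof.
move=> a0; have zi : 0 < z i by apply: laguerre_zero_gt0.
have zne (j : 'I_m) : j != i -> z i != z j.
  rewrite -val_eqE /= neq_ltn => /orP[] h.
  - by rewrite gt_eqF // laguerre_zero_lt // h /=.
  - by rewrite lt_eqF // laguerre_zero_lt // h /=.
have d2 := deriv2_prod_XsubC_root zne.
have dne : (laguerre a m)^`().[z i] != 0.
  have := sign_deriv_rootsR (monic_laguerre a m) (size_laguerre a m)
    (size_rootsR_laguerre m a0) (ltn_ord i).
  by rewrite -/(laguerre_zero a m i) -/(z i) => /lt0r_neq0;
    rewrite mulf_eq0 negb_or => /andP[].
rewrite -laguerre_prod // in d2.
have /rootP rt : root (laguerre a m) (z i).
  by rewrite root_nth_rootsR ?laguerre_neq0 ?size_rootsR_laguerre.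
have := congr1 (horner^~ (z i)) (laguerre_ode a m).
rewrite !(hornerD, hornerM, hornerN, hornerC, hornerX) rt d2 mulr0 addr0.
set S := \sum_(_ < _ | _) _; set d := _.[z i] in dne *; move=> E.
apply: (mulIf dne); apply: (mulIf (lt0r_neq0 zi)); apply/eqP;
  rewrite -subr_eq0 -[X in _ == X]E.
by apply/eqP; field; rewrite gt_eqF.
Qed.

(** Let [k] minimize the displacement [d]. Then no difference [z_k - z_j] grows from [a] to [b], and
    each keeps its sign, so no reciprocal decreases. If moreover [d k <= 0], then [a / z_k] strictly
    increases, and the two equilibrium sums at [k] cannot both equal 1. *)
Lemma laguerre_zero_increasing a b m i : 0 < a -> a < b -> (i < m)%N ->
  laguerre_zero a m i < laguerre_zero b m i.
Proof.
move=> a0 ab im; have b0 := lt_trans a0 ab.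
pose d (j : 'I_m) := laguerre_zero b m j - laguerre_zero a m j.
rewrite -subr_gt0 -[_ - _]/(d (Ordinal im)).
case: (@arg_minP _ _ _ (Ordinal im) xpredT d) => // k _ kmin.
apply: lt_le_trans (kmin _ isT); rewrite ltNge; apply/negP => dk0.
have Ea := laguerre_zero_equilibrium k a0; have Eb := laguerre_zero_equilibrium k b0.
have za := laguerre_zero_gt0 a0 (ltn_ord k);
  have zb := laguerre_zero_gt0 b0 (ltn_ord k).
have zba : laguerre_zero b m k <= laguerre_zero a m k by rewrite -subr_le0.
have := ltxx (1 : R); rewrite -[X in _ < X]Eb -[X in X < _]Ea => /negbT/negP; apply.
apply: ler_ltD; last first.
  apply: lt_le_trans (_ : b / laguerre_zero a m k <= _).
    by rewrite ltr_pM2r ?invr_gt0.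
  by rewrite ler_pM2l // lef_pV2.
rewrite ler_pM2l ?ltr0n //; apply: ler_sum => j jk.
have kj := kmin j isT; rewrite /d in kj.
have le : laguerre_zero b m k - laguerre_zero b m j <=
          laguerre_zero a m k - laguerre_zero a m j by lra.
move: jk; rewrite -val_eqE /= neq_ltn => /orP[] h.
  have := @laguerre_zero_lt a m j k a0; have := @laguerre_zero_lt b m j k b0.
  rewrite h ltn_ord => /(_ isT) ? /(_ isT) ?.
  by rewrite lef_pV2 ?posrE ?subr_gt0.
have := @laguerre_zero_lt a m k j a0; have := @laguerre_zero_lt b m k j b0.
rewrite h ltn_ord => /(_ isT) ? /(_ isT) ?.
by rewrite lef_nV2 ?negrE ?subr_lt0.
Qed.

End Laguerre.

(** * Regular zeros through the logarithmic derivative *)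

Section RegularZeros.
Variable R : rcfType.
Implicit Types (a b x y : R) (z : nat -> R) (m n i j : nat).

(* For [z] sorted: [x] lies between [z i] and the next point of [z]. *)
Definition in_gap n z i x :=
  forall j, (j < n)%N -> if (j <= i)%N then z j < x else x < z j.

(* With the zeros of [q := laguerre a n] for [z], this is the logarithmic
   derivative of [q e^(-x) / (x + a)], whose derivative carries the zeros of
   the X_1-Laguerre polynomial. *)
Definition log_deriv n z a x := \sum_(j < n) (x - z j)^-1 - 1 - (x + a)^-1.

(** The disjunction places [u] and [v] on the same side of [x]. *)
Lemma ltr_inv_sub x u v : (v < x) || (x < u) -> u < v -> (x - u)^-1 < (x - v)^-1.
Proof.
case/orP => h uv.
  by rewrite ltf_pV2 ?posrE; lra.
by rewrite ltf_nV2 ?negrE; lra.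
Qed.

Lemma in_gap_gt0 n z i x : (i < n)%N -> 0 < z 0%N -> in_gap n z i x -> 0 < x.
Proof. by move=> lt z0 /(_ 0 (leq_ltn_trans (leq0n _) lt))/(lt_trans z0). Qed.

(** Every [1 / (x - z_j)] decreases on the gap. Only [- 1 / (x + a)] increases, and by less than the
    term of the smallest [z_j] loses. *)
Lemma log_deriv_decr n z a i x y : 0 < a -> 0 < z 0%N -> (i < n)%N ->
    in_gap n z i x -> in_gap n z i y -> x < y ->
  log_deriv n z a y < log_deriv n z a x.
Proof.
move=> a0 z0; case: n => // n lt gx gy xy.
have x0 := in_gap_gt0 lt z0 gx; have y0 := in_gap_gt0 lt z0 gy.
have incr j : (j < n.+1)%N -> (y - z j)^-1 <= (x - z j)^-1.
  move=> jn; have := gx j jn; have := gy j jn; case: leqP => _ h1 h2.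
    by rewrite lef_pV2 ?posrE ?subr_gt0 // lerD2r ltW.
  by rewrite lef_nV2 ?negrE ?subr_lt0 // lerD2r ltW.
rewrite /log_deriv !big_ord_recl /=.
have : \sum_(j < n) (y - z (lift ord0 j))^-1 <=
       \sum_(j < n) (x - z (lift ord0 j))^-1.
  by apply: ler_sum => j _; exact: incr (ltn_ord _).
have := gx 0%N isT; have := gy 0%N isT; rewrite leq0n -subr_gt0 -[_ < x]subr_gt0 =>
  hy hx.
(* The pole at [z 0%N] is closer to [x] and [y] than [- a]. *)
have : (x + a)^-1 - (y + a)^-1 < (x - z 0%N)^-1 - (y - z 0%N)^-1.
  have -> : (x + a)^-1 - (y + a)^-1 = (y - x) / ((x + a) * (y + a)).
    by field; rewrite !gt_eqF ?addr_gt0.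
  have -> : (x - z 0%N)^-1 - (y - z 0%N)^-1 = (y - x) / ((x - z 0%N) * (y - z 0%N)).
    by field; rewrite !gt_eqF.
  rewrite ltr_pM2l ?subr_gt0 // ltf_pV2  ?posrE; last 2 first.
  - by rewrite mulr_gt0 ?addr_gt0.
  - exact: mulr_gt0.
  by apply: ltr_pM; rewrite ?ltW //; lra.

by move=> *; lra.
Qed.

(** The comparison principle behind monotonicity and interlacing: a regular zero [x] of one
    polynomial is tested in the logarithmic derivative belonging to another, whose zero in that gap
    is [y]. *)
Lemma log_deriv_lt n z a i x y : 0 < a -> 0 < z 0%N -> (i < n)%N ->
    in_gap n z i x -> in_gap n z i y ->
  log_deriv n z a y = 0 -> 0 < log_deriv n z a x -> x < y.
Proof.
move=> a0 z0 lt gx gy ly lx; case: (ltgtP x y) => // [yx|exy].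
  by have := log_deriv_decr a0 z0 lt gy gx yx; rewrite ly ltNge (ltW lx).
by move: lx; rewrite exy ly ltxx.
Qed.

(** The polynomial [P] of the overview for the monic [q]; Gram-Schmidt turns out to return exactly
    this normalization. *)
Definition exceptional_laguerre a m : {poly R} :=
  ('X + (a + 1)%:P) * laguerre a m - ('X + a%:P) * (laguerre a m)^`().

Lemma size_monic_exceptional_laguerre a m :
  exceptional_laguerre a m \is monic /\ size (exceptional_laguerre a m) = m.+2.
Proof.
have mon := monic_laguerre a m; have sz := size_laguerre a m.
rewrite /exceptional_laguerre; set q := laguerre a m in mon sz *.
have sXq : size ('X * q) = m.+2 by rewrite mulrC size_mulX ?monic_neq0 // sz.
have -> : ('X + (a + 1)%:P) * q - ('X + a%:P) * q^`() =
    'X * q + ((a + 1)%:P * q - ('X + a%:P) * q^`()) by ring.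
have lt : (size ((a + 1)%:P * q - ('X + a%:P) * q^`())%R < size ('X * q)%R)%N.
  rewrite sXq ltnS (leq_trans (size_polyD _ _)) // geq_max size_polyN.
  rewrite mul_polyC (leq_trans (size_scale_leq _ _)) ?sz //=.
  rewrite mulrC (leq_trans (size_polyMleq _ _)) // size_XaddC addn2 /=.
  by rewrite -sz lt_size_deriv ?monic_neq0.
rewrite size_polyDl // sXq; split=> //.
by rewrite monicE lead_coefDl // lead_coefM lead_coefX mul1r (monicP mon).
Qed.

Lemma monic_exceptional_laguerre a m : exceptional_laguerre a m \is monic.
Proof. by have [] := size_monic_exceptional_laguerre a m. Qed.

Lemma size_exceptional_laguerre a m : size (exceptional_laguerre a m) = m.+2.
Proof. by have [] := size_monic_exceptional_laguerre a m. Qed.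

Lemma exceptional_laguerre_neq0 a m : exceptional_laguerre a m != 0.
Proof. exact/monic_neq0/monic_exceptional_laguerre. Qed.

Lemma horner_exceptional_laguerre a m x : (exceptional_laguerre a m).[x] =
  (x + a + 1) * (laguerre a m).[x] - (x + a) * (laguerre a m)^`().[x].
Proof. by rewrite !(hornerD, hornerM, hornerN, hornerC, hornerX) addrA. Qed.

(* [exceptional_laguerre a m] has degree [m.+1], and its root of index 0 is the
   exceptional zero. *)
Definition regular_zero a m i : R := nth 0 (rootsR (exceptional_laguerre a m)) i.+1.

(** [P] equals [q(- a)] at [- a] and [- (z + a) q'(z)] at a zero [z] of [q]. Its signs therefore
    alternate along a far negative point, [- a], the zeros of [q] and a far positive point, except
    that nothing is claimed between [- a] and the first zero of [q]. *)
Lemma exceptional_laguerre_zeros a m : 0 < a ->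
  size (rootsR (exceptional_laguerre a m)) = m.+1 /\
  forall i, (i < m)%N -> in_gap m (laguerre_zero a m) i (regular_zero a m i).
Proof.
move=> a0; set p := exceptional_laguerre a m.
have mon := monic_laguerre a m; have sz := size_laguerre a m.
have sr := size_rootsR_laguerre m a0.
have pmon := monic_exceptional_laguerre a m; have psz := size_exceptional_laguerre a m.
have [M tM pM] := monic_pinfty (laguerre_zero a m m.-1) pmon.
have [N Na] := monic_minfty (- a) pmon; rewrite psz -/p [_.+2.-1]/= => pN.
(* Interval 0 catches the exceptional zero; interval [j.+1] is the gap after the zero [j] of [q],
   closed by [M] after the last one. *)
pose l i := if i is j.+1 then laguerre_zero a m j else N.
pose r i := if i is j.+1 then if (j.+1 < m)%N then laguerre_zero a m j.+1 else M
            else - a.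
have sgz i : (i < m)%N -> 0 < (-1) ^+ (m - i) * p.[laguerre_zero a m i].
  move=> im; rewrite horner_exceptional_laguerre.
  have /rootP -> : root (laguerre a m) (laguerre_zero a m i).
    by rewrite root_nth_rootsR ?laguerre_neq0 ?sr.
  have za : 0 < laguerre_zero a m i + a by rewrite addr_gt0 ?laguerre_zero_gt0.
  have := mulr_gt0 za (sign_deriv_rootsR mon sz sr im).
  rewrite -/(laguerre_zero a m i) -[(m - i)%N](@subnSK i m) // exprS.
  congr (_ < _); ring.
have [||i|-> h] := @rootsR_sign_changes _ p m.+1 l r psz.
- move=> [|i] //; rewrite ltnS /= => im.
  case: ltnP => im1; first by rewrite laguerre_zero_lt ?ltnSn.
  suff -> : i = m.-1 by [].
  by apply/eqP; rewrite eqn_leq -ltnS (ltn_predK im) im -(leq_add2r 1) !addn1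
    (ltn_predK im).
- move=> [_|i]; last first.
    rewrite ltnS /= => im; apply: (@mulr_lt0_signS _ (m - i.+1)).
      by rewrite subnSK // sgz.
    case: ltnP => im1; first exact: sgz.
    have -> : (m - i.+1 = 0)%N by apply/eqP; rewrite subn_eq0.
    by rewrite mul1r.
  apply: (@mulr_lt0_signS _ m) => //=.
  rewrite horner_exceptional_laguerre addNr add0r mul1r mul0r subr0.
  rewrite -[m in _ ^+ m]subn0; apply: sign_horner_rootsR => // j jm _.
  by apply: lt_trans (laguerre_zero_gt0 a0 jm); rewrite oppr_lt0.
- by case: i => [|i]; rewrite ltnS /= => im; rewrite ?im // ltW //
  (lt_trans _ (laguerre_zero_gt0 a0 im)) // oppr_lt0.
split=> // i im j jm; have /andP[] := h i.+1 im;
  rewrite -/(regular_zero a m i) /= => h1 h2.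
case: leqP => ij.
  by apply: le_lt_trans h1; move: ij; rewrite leq_eqVlt => /orP[/eqP->//|ij];
    rewrite ltW // laguerre_zero_lt // ij.
move: h2; rewrite (leq_ltn_trans ij jm) => /lt_le_trans; apply.
by move: ij; rewrite leq_eqVlt => /orP[/eqP->//|ij]; rewrite ltW //
  laguerre_zero_lt // ij.
Qed.

Lemma size_rootsR_exceptional_laguerre a m : 0 < a ->
  size (rootsR (exceptional_laguerre a m)) = m.+1.
Proof. by move=> a0; have [] := exceptional_laguerre_zeros m a0. Qed.

Lemma regular_zero_gap a m i : 0 < a -> (i < m)%N ->
  in_gap m (laguerre_zero a m) i (regular_zero a m i).
Proof. by move=> a0; have [_] := exceptional_laguerre_zeros m a0; apply. Qed.

Lemma laguerre_zero_lt_regular a m i : 0 < a -> (i < m)%N ->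
  laguerre_zero a m i < regular_zero a m i.
Proof. by move=> a0 im; have := regular_zero_gap a0 im im; rewrite leqnn. Qed.

Lemma regular_zero_gt0 a m i : 0 < a -> (i < m)%N -> 0 < regular_zero a m i.
Proof.
move=> a0 im; apply: lt_trans (laguerre_zero_lt_regular a0 im).
exact: laguerre_zero_gt0.
Qed.

(** The logarithmic derivative is [- P / ((x + a) q)], whose denominator does not vanish at a
    regular zero. *)
Lemma log_deriv_regular_zero a m i : 0 < a -> (i < m)%N ->
  log_deriv m (laguerre_zero a m) a (regular_zero a m i) = 0.
Proof.
move=> a0 im; have x0 := regular_zero_gt0 a0 im.
have := regular_zero_gap a0 im.
have /rootP : root (exceptional_laguerre a m) (regular_zero a m i).
  by rewrite root_nth_rootsR ?exceptional_laguerre_neq0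
    ?size_rootsR_exceptional_laguerre.
set x := regular_zero a m i in x0 *; rewrite horner_exceptional_laguerre => px gx.
have xz (j : 'I_m) : true -> x != laguerre_zero a m j.
  by have := gx j (ltn_ord j); case: leqP => _ h _; rewrite ?(gt_eqF h) ?(lt_eqF h).
have qx := laguerre_prod m a0.
move: px; rewrite {2}qx (deriv_prod_XsubC xz) -horner_prod_XsubC -qx.
have q0 : (laguerre a m).[x] != 0.
  rewrite qx horner_prod_XsubC; apply/prodf_neq0 => j _.
  by rewrite subr_eq0 xz.
rewrite /log_deriv; set S := \sum_(_ < _) _ => px.
have xa : x + a != 0 by rewrite gt_eqF ?addr_gt0.
apply: (mulfI q0); apply: (mulfI xa); rewrite !mulr0 -[RHS]oppr0 -[in RHS]px.
by field.
Qed.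

(** Unless the Laguerre zero for [b] already separates the two regular zeros, [x] lies in gap [i]
    for both parameters. Passing to [b] moves every [z_j] to the right and shrinks [1 / (x + a)], so
    the logarithmic derivative at [x] becomes positive. *)
Lemma regular_zero_increasing a b m i : 0 < a -> a < b -> (i < m)%N ->
  regular_zero a m i < regular_zero b m i.
Proof.
move=> a0 ab im; have b0 := lt_trans a0 ab.
have [le|lt] := leP (regular_zero a m i) (laguerre_zero b m i).
  by apply: le_lt_trans le _; apply: laguerre_zero_lt_regular.
have ga := regular_zero_gap a0 im; have la := log_deriv_regular_zero a0 im.
have x0 := regular_zero_gt0 a0 im.
set x := regular_zero a m i in lt ga la x0 *.
have gb : in_gap m (laguerre_zero b m) i x.
  move=> j jm; have := ga j jm; case: leqP => [ij _|_ h].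
    apply: le_lt_trans lt; move: ij; rewrite leq_eqVlt => /orP[/eqP->//|ij].
    by rewrite ltW // laguerre_zero_lt // ij.
  by apply: lt_trans h _; apply: laguerre_zero_increasing.
apply: (log_deriv_lt b0 _ im gb (regular_zero_gap b0 im)).
- by apply: laguerre_zero_gt0 => //; apply: leq_ltn_trans im.
- exact: log_deriv_regular_zero.
rewrite -[X in X < _]la /log_deriv.
have : (x + b)^-1 < (x + a)^-1 by rewrite ltf_pV2 ?posrE ?addr_gt0 // ltrD2l.
have : \sum_(j < m) (x - laguerre_zero a m j)^-1 <=
       \sum_(j < m) (x - laguerre_zero b m j)^-1.
  apply: ler_sum => j _; apply/ltW/ltr_inv_sub; last exact: laguerre_zero_increasing.
  by have := ga j (ltn_ord j); have := gb j (ltn_ord j); case: leqP => _ h1 h2;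
    rewrite ?h1 ?h2 ?orbT.
lra.
Qed.

(** Going from degree [m.+1] down to [m] replaces each [z_j] by a larger zero and drops the term of
    the last one, which is negative at [x]; both changes raise the logarithmic derivative. *)
Lemma regular_zero_interlace_left a m i : 0 < a -> (i < m)%N ->
  regular_zero a m.+1 i < regular_zero a m i.
Proof.
move=> a0 im; have im' := ltnW im.
have [le|lt] := leP (regular_zero a m.+1 i) (laguerre_zero a m i).
  by apply: le_lt_trans le _; apply: laguerre_zero_lt_regular.
have ga := regular_zero_gap a0 (im' : (i < m.+1)%N).
have la := log_deriv_regular_zero a0 (im' : (i < m.+1)%N).
set x := regular_zero a m.+1 i in lt ga la *.
have inter j (jm : (j < m)%N) := laguerre_zero_interlace a0 jm.
have gb : in_gap m (laguerre_zero a m) i x.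
  move=> j jm; have := ga j (ltnW jm); case: leqP => [ij _|_ h].
    apply: le_lt_trans lt; move: ij; rewrite leq_eqVlt => /orP[/eqP->//|ij].
    by rewrite ltW // laguerre_zero_lt // ij.
  by apply: lt_trans h _; have /andP[] := inter j jm.
apply: (log_deriv_lt a0 _ im gb (regular_zero_gap a0 im)).
- by apply: laguerre_zero_gt0 => //; apply: leq_ltn_trans im.
- exact: log_deriv_regular_zero.
rewrite -[X in X < _]la /log_deriv big_ord_recr /=.
have : (x - laguerre_zero a m.+1 m)^-1 < 0.
  by rewrite invr_lt0 subr_lt0; have := ga m (ltnSn m); rewrite leqNgt im.
have : \sum_(j < m) (x - laguerre_zero a m.+1 j)^-1 <=
       \sum_(j < m) (x - laguerre_zero a m j)^-1.
  apply: ler_sum => j _; apply/ltW/ltr_inv_sub;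
    last by have /andP[] := inter j (ltn_ord j).
  by have := ga j (ltnW (ltn_ord j)); have := gb j (ltn_ord j); case: leqP =>
    _ h1 h2; rewrite ?h1 ?h2 ?orbT.
lra.
Qed.

(** Going up to degree [m.+1], zero [j] is matched with the larger zero [j.+1]; the unmatched
    smallest zero lies below [x] and adds a positive term. *)
Lemma regular_zero_interlace_right a m i : 0 < a -> (i < m)%N ->
  regular_zero a m i < regular_zero a m.+1 i.+1.
Proof.
move=> a0 im.
have [le|lt] := leP (regular_zero a m i) (laguerre_zero a m.+1 i.+1).
  by apply: le_lt_trans le _; apply: laguerre_zero_lt_regular.
have ga := regular_zero_gap a0 im; have la := log_deriv_regular_zero a0 im.
set x := regular_zero a m i in lt ga la *.
have inter j (jm : (j < m)%N) := laguerre_zero_interlace a0 jm.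
have gb : in_gap m.+1 (laguerre_zero a m.+1) i.+1 x.
  move=> j jm; case: leqP => [|ij].
    rewrite leq_eqVlt => /orP[/eqP->//|ij]; apply: lt_trans lt.
    by rewrite laguerre_zero_lt // ij.
  case: j jm ij => // j jm ij; rewrite ltnS in ij.
  have := ga j jm; rewrite leqNgt ij => /lt_trans; apply.
  by have /andP[] := inter j jm.
apply: (log_deriv_lt a0 _ (im : (i.+1 < m.+1)%N) gb (regular_zero_gap a0 (im :
  (i.+1 < m.+1)%N))).
- exact: laguerre_zero_gt0.
- exact: log_deriv_regular_zero.
rewrite -[X in X < _]la /log_deriv big_ord_recl /=.
have : 0 < (x - laguerre_zero a m.+1 0%N)^-1.
  by rewrite invr_gt0 subr_gt0; have := gb 0%N isT.
have : \sum_(j < m) (x - laguerre_zero a m j)^-1 <=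
       \sum_(j < m) (x - laguerre_zero a m.+1 (lift ord0 j))^-1.
  apply: ler_sum => j _; have /andP[_ h] := inter j (ltn_ord j).
  apply/ltW/ltr_inv_sub => //.
  by have := ga j (ltn_ord j); have := gb j.+1 (ltn_ord j); rewrite ltnS; case:
    leqP => _ h1 h2; rewrite ?h1 ?h2 ?orbT.
lra.
Qed.

End RegularZeros.

(** * The fundamental theorem of calculus on a half-line under domination *)

Section DominatedFTC.
Variable R : realType.
Notation mu := (@lebesgue_measure R).
Local Open Scope classical_set_scope.

(** Domination makes [f + g] and [g] nonnegative, so the theorem for nonnegative integrands applies
    to both, and [f] is their difference. *)
Lemma dominated_continuous_FTC2y (f F g G : R -> R) (a l k : R) :
    (forall x, a <= x -> `|f x| <= g x) ->
    {within `[a, +oo[, continuous f} -> {within `[a, +oo[, continuous g} ->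
    (forall x, a < x -> is_derive x 1 F (f x)) ->
    (forall x, a < x -> is_derive x 1 G (g x)) ->
    F x @[x --> +oo] --> l -> G x @[x --> +oo] --> k ->
    F x @[x --> a^'+] --> F a -> G x @[x --> a^'+] --> G a ->
  mu.-integrable `[a, +oo[ (EFin \o f) /\ \int[mu]_(x in `[a, +oo[) f x = l - F a.
Proof.
move=> fg cf cg dF dG Fl Gk Fa Ga.
have g0 x : a <= x -> 0 <= g x by move=> /fg; apply: le_trans.
have meas (h : R -> R) : {within `[a, +oo[, continuous h} -> measurable_fun `[a, +oo[ h.
  by apply: subspace_continuous_measurable_fun; exact: measurable_itv.
have int (h H : R -> R) c : (forall x, a <= x -> 0 <= h x) ->
    {within `[a, +oo[, continuous h} ->
    (forall x, a < x -> is_derive x 1 H (h x)) ->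
    H x @[x --> +oo] --> c -> H x @[x --> a^'+] --> H a ->
    mu.-integrable `[a, +oo[ (EFin \o h) /\
    \int[mu]_(x in `[a, +oo[) h x = c - H a.
  move=> h0 ch dH Hc Ha.
  have E : (\int[mu]_(x in `[a, +oo[) (h x)%:E = c%:E - (H a)%:E)%E.
    apply: ge0_continuous_FTC2y => // x; first by move=> /dH[].
    by rewrite in_itv/= andbT => ax; rewrite derive1E; have [_] := dH x ax.
  split; last by rewrite /Rintegral E.
  apply/integrableP; split; first by apply/measurable_EFinP; exact: meas.
  rewrite (_ : (\int[mu]_(x in _) _)%E = (\int[mu]_(x in `[a, +oo[) (h x)%:E)%E).
    by rewrite E ltry.
  apply: eq_integral => x; rewrite inE /= in_itv /= andbT => ax.
  by rewrite ger0_norm ?h0.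
have [ig Ig] := int g G k g0 cg dG Gk Ga.
have [ifg Ifg] : mu.-integrable `[a, +oo[ (EFin \o (f \+ g)) /\
    \int[mu]_(x in `[a, +oo[) (f \+ g) x = l + k - (F \+ G) a.
  apply: int.
  - by move=> x /fg /=; rewrite ler_norml => /andP[? _]; lra.
  - by move=> x; apply: cvgD; [exact: cf|exact: cg].
  - by move=> x ax; apply: is_deriveD; [exact: dF|exact: dG].
  - exact: cvgD.
  - exact: cvgD.
have fE : f = (f \+ g) \- g by apply/funext => x /=; rewrite addrK.
split.
  rewrite fE; have := integrableB _ ifg ig; apply; exact: measurable_itv.
rewrite fE (RintegralB _ ifg ig); last exact: measurable_itv.
rewrite Ifg Ig /=; ring.
Qed.

End DominatedFTC.

(** * The weight: decay, derivative, and the inner product it defines *)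

Section Weight.
Variable R : realType.
Implicit Types (a x c C : R) (p q : {poly R}).
Local Open Scope classical_set_scope.

(** Induction along Horner's scheme: half of the exponent serves the induction hypothesis, the other
    half absorbs the factor [x]. *)
Lemma poly_le_expR p c : 0 < c ->
  exists2 C, 0 <= C & forall x, 0 <= x -> `|p.[x]| <= C * expR (c * x).
Proof.
elim/poly_ind: p c => [|p d ih] c c0.
  by exists 0 => // x _; rewrite horner0 normr0 mul0r.
have c2 : 0 < c / 2 by rewrite divr_gt0.
have [C C0 hC] := ih _ c2.
exists (C / (c / 2) + `|d|) => [|x x0]; first by rewrite addr_ge0 // divr_ge0 // ltW.
rewrite hornerMXaddC (le_trans (ler_normD _ _)) // mulrDl lerD //.
  rewrite normrM (ger0_norm x0).
  have xe : x <= (c / 2)^-1 * expR (c / 2 * x).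
    rewrite ler_pdivlMl // (le_trans _ (expR_ge1Dx _)) // lerDr //.
  have -> : expR (c * x) = expR (c / 2 * x) * expR (c / 2 * x).
    by rewrite -expRD; congr expR; field.
  rewrite [leRHS](_ : _ = (C * expR (c / 2 * x)) * ((c / 2)^-1 * expR (c / 2 *
    x))); last by ring.
  by apply: ler_pM => //; exact: hC.
by rewrite ler_peMr // (le_trans _ (expR_ge1Dx _)) // lerDl mulr_ge0 // ltW.
Qed.

Lemma powR_le_expr a : 0 <= a ->
  exists n : nat, forall x, 0 <= x -> x `^ a <= 1 + x ^+ n.
Proof.
move=> a0; exists (Num.truncn a).+1 => x x0.
case: (leP x 1) => x1.
  have : x `^ a <= 1 `^ a by apply: ge0_ler_powR; rewrite ?nnegrE.
  by rewrite powR1 => /le_trans; apply; rewrite lerDl exprn_ge0.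
apply: (@le_trans _ _ (x ^+ (Num.truncn a).+1)); last by rewrite lerDr.
by rewrite -powR_mulrn // ler_powR ?ltW // truncnS_gt.
Qed.

Definition X1_density a p x := p.[x] * X1_weight a x.

(** Half of the decay of [e^(-x)] absorbs [p] and the bound [1 + x^n] for [x^a], while [(x + a)^2]
    is at least [a^2]. *)
Lemma X1_density_le a p : 0 < a ->
  exists C, forall x, 0 <= x -> `|X1_density a p x| <= C * expR (- (x / 2)).
Proof.
move=> a0; have [n hn] := powR_le_expr (ltW a0).
have [|C C0 hC] := @poly_le_expR (p * (1 + 'X^n)) 2^-1; first by rewrite invr_gt0.
exists (C / a ^+ 2) => x x0.
have xa : a ^+ 2 <= (x + a) ^+ 2 by rewrite lerXn2r ?nnegrE ?addr_ge0 ?(ltW a0) //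
  lerDr.
have a2 : 0 < a ^+ 2 by rewrite exprn_gt0.
set E := expR (- (x / 2)); have E0 : 0 <= E by apply: expR_ge0.
have eE : expR (2^-1 * x) * E = 1.
  by rewrite -expRD -[RHS]expR0; congr expR; ring.
have w0 : 0 <= X1_weight a x.
  by rewrite !mulr_ge0 ?expR_ge0 ?powR_ge0 // invr_ge0 exprn_ge0 // addr_ge0 // ltW.
have wE : X1_weight a x <= E * E * ((1 + x ^+ n) / a ^+ 2).
  rewrite /X1_weight (_ : - x = - (x / 2) - x / 2); last by field.
  rewrite expRD -mulrA ler_wpM2l ?mulr_ge0 //
    ler_pM ?powR_ge0 ?invr_ge0 ?sqr_ge0 ?hn //.
  by rewrite lef_pV2 // posrE (lt_le_trans a2).
have pE : `|p.[x]| * (1 + x ^+ n) <= C * expR (2^-1 * x).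
  have := hC x x0; rewrite hornerM normrM hornerD hornerC hornerXn.
  by rewrite [`|1 + _|]ger0_norm // addr_ge0 ?exprn_ge0.
rewrite normrM [`|X1_weight _ _|]ger0_norm // (le_trans (ler_wpM2l _ wE)) //.
rewrite [leLHS](_ : _ = `|p.[x]| * (1 + x ^+ n) * (E * E / a ^+ 2)); last by ring.
have EE0 : 0 <= E * E / a ^+ 2 by rewrite divr_ge0 ?mulr_ge0 // ltW.
apply: (le_trans (ler_wpM2r EE0 pE)).
rewrite [leLHS](_ : _ = C / a ^+ 2 * E * (expR (2^-1 * x) * E)); last by ring.
by rewrite eE mulr1.
Qed.

(** The factor in front is the logarithmic derivative of the weight. *)
Lemma is_derive_X1_weight a x : 0 < a -> 0 < x ->
  is_derive x 1 (X1_weight a) ((a / x - 1 - 2 / (x + a)) * X1_weight a x).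
Proof.
move=> a0 x0; have xa : x + a != 0 by rewrite gt_eqF ?addr_gt0.
have d1 : is_derive x 1 (fun y : R => expR (- y)) (- expR (- x)).
  rewrite -mulrN1; apply: (is_derive1_comp (f := @expR R) (g := fun y : R => - y)).
have d2 := is_derive1_powR a x0.
have d3 : is_derive x 1 (fun y : R => (y + a)^-1) (- (x + a) ^- 2).
  have := @is_deriveV R (fun y => y + a) x 1 1 xa.
  rewrite /GRing.scale /= mulr1; apply; rewrite -[X in is_derive _ _ _ X]addr0.
  exact: is_deriveD.
have d : is_derive x 1 (fun y : R => expR (- y) * y `^ a * ((y + a)^-1 * (y + a)^-1))
    ((a / x - 1 - 2 / (x + a)) * X1_weight a x).
  have := is_deriveM (is_deriveM d1 d2) (is_deriveM d3 d3).
  congr (is_derive _ _ _ _).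
  rewrite /X1_weight /GRing.scale /=.
  rewrite !mulrfctE powRB; last by apply/implyP => _; rewrite gt_eqF.
  rewrite powRr1 ?ltW //.
  by field; rewrite xa gt_eqF.
have E : X1_weight a = fun y : R => expR (- y) * y `^ a * ((y + a)^-1 * (y + a)^-1).
  by apply/funext => y; rewrite /X1_weight expr2 invfM.
by rewrite -E in d.
Qed.

Lemma is_derive_X1_density a p x : 0 < a -> 0 < x ->
  is_derive x 1 (X1_density a p)
    ((p^`().[x] + p.[x] * (a / x - 1 - 2 / (x + a))) * X1_weight a x).
Proof.
move=> a0 x0; have := is_deriveM (is_derive_poly p x) (is_derive_X1_weight a0 x0).
by congr (is_derive _ _ _ _); rewrite /GRing.scale /=; ring.
Qed.

Lemma X1_density0 a p : 0 < a -> X1_density a p 0 = 0.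
Proof. by move=> a0; rewrite /X1_density /X1_weight powR0 ?gt_eqF // !(mulr0,
  mul0r). Qed.

Lemma X1_weight_ge0 a x : 0 <= X1_weight a x.
Proof. by rewrite !mulr_ge0 ?expR_ge0 ?powR_ge0 ?invr_ge0 ?sqr_ge0. Qed.

Lemma X1_weight_gt0 a x : 0 < a -> 0 < x -> 0 < X1_weight a x.
Proof.
by move=> a0 x0; rewrite divr_gt0 ?mulr_gt0 ?expR_gt0 ?powR_gt0 ?exprn_gt0 ?addr_gt0.
Qed.

Lemma X1_density_cvg0 a p :
  0 < a -> X1_density a p x @[x --> 0^'+] --> X1_density a p 0.
Proof.
move=> a0; rewrite X1_density0 // -[X in _ --> X](mulr0 p.[0]).
apply: cvgM; first by apply: cvg_at_right_filter; exact: continuous_horner.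
apply: (@squeeze_cvgr _ _ _ _ (fun=> 0) (fun x => (a ^+ 2)^-1 * x `^ a)); last 2 first.
- exact: cvg_cst.
- by rewrite -[X in _ --> X](mulr0 (a ^+ 2)^-1); apply: cvgMr; exact: powR_cvg0.
near=> x; rewrite X1_weight_ge0 /=.
have x0 : 0 < x by near: x; exact: nbhs_right_gt.
rewrite /X1_weight mulrC ler_pM ?invr_ge0 ?sqr_ge0 ?mulr_ge0 ?expR_ge0 ?powR_ge0 //.
  by rewrite lef_pV2 ?posrE ?exprn_gt0 ?addr_gt0 //
    lerXn2r ?nnegrE ?addr_ge0 ?(ltW a0) ?(ltW x0) // lerDr ltW.
by rewrite ler_piMl ?powR_ge0 // -expR0 ler_expR oppr_le0 ltW.
Unshelve. all: by end_near. Qed.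

Lemma X1_density_continuous a p : 0 < a -> {within `[0, +oo[,
  continuous (X1_density a p)}.
Proof.
move=> a0; apply/continuous_within_itvcyP; split; last exact: X1_density_cvg0.
move=> x; rewrite in_itv /= andbT => x0.
apply: differentiable_continuous; apply/derivable1_diffP.
by have [] := is_derive_X1_density p a0 x0.
Qed.

Lemma expRN_half_cvgy : expR (- (x / 2)) @[x --> +oo] --> (0 : R).
Proof.
apply: (@cvg_comp _ _ _ (fun x : R => x / 2) (fun y => expR (- y)) _ (@pinfty_nbhs R)).
  by apply: gt0_cvgMly => //; rewrite invr_gt0.
exact: cvgr_expR.
Qed.

Lemma X1_density_cvgy a p : 0 < a -> X1_density a p x @[x --> +oo] --> 0.
Proof.
move=> a0; have [C hC] := X1_density_le p a0.
apply: (@squeeze_cvgr _ _ _ _ (fun x => - (C * expR (- (x / 2))))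
  (fun x => C * expR (- (x / 2)))).
- near=> x; rewrite -ler_norml; apply: hC.
  by near: x; apply: nbhs_pinfty_ge; exact: num_real.
- rewrite -oppr0 -[X in - X](mulr0 C); apply: cvgN; apply: cvgMr; exact:
  expRN_half_cvgy.
- rewrite -[X in _ --> X](mulr0 C); apply: cvgMr; exact: expRN_half_cvgy.
Unshelve. all: by end_near. Qed.

Lemma is_derive_expRN_half C x :
  is_derive x 1 (fun y => - 2 * C * expR (- (y / 2))) (C * expR (- (x / 2))).
Proof.
have d1 : is_derive x 1 (fun y : R => - (y / 2)) (- 2^-1).
  have := @is_deriveZ _ _ R id (- 2^-1) x 1 1 (is_derive_id _ _).
  rewrite /GRing.scale /= mulr1; congr (is_derive _ _ _ _).
  apply/funext => y; transitivity (- 2^-1 * y); [by []|ring].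
have := @is_deriveZ _ _ R _ (- 2 * C) x 1 _ (is_derive1_comp (is_derive_expR _) d1).
by congr (is_derive _ _ _ _); rewrite /GRing.scale /=; field.
Qed.

Lemma continuous_expRN_half C : continuous (fun x : R => C * expR (- (x / 2))).
Proof.
move=> x; apply: differentiable_continuous; apply/derivable1_diffP.
have [] := is_derive_expRN_half (- 2^-1 * C) x.
by rewrite (_ : - 2 * (- 2^-1 * C) = C) //; field.
Qed.

Lemma expRN_half_FTC C (f F : R -> R) :
    (forall x, 0 <= x -> `|f x| <= C * expR (- (x / 2))) ->
    {within `[0, +oo[, continuous f} ->
    (forall x, 0 < x -> is_derive x 1 F (f x)) ->
    F x @[x --> +oo] --> (0 : R) -> F x @[x --> 0^'+] --> F 0 ->
  (@lebesgue_measure R).-integrable `[0, +oo[ (EFin \o f) /\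
  \int[lebesgue_measure]_(x in `[0, +oo[) f x = - F 0.
Proof.
move=> fC cf dF Fy F0; rewrite -[X in _ = X]add0r.
apply: (@dominated_continuous_FTC2y R f F _ (fun x =>
  - 2 * C * expR (- (x / 2))) 0 0 0 fC) => //.
- exact/continuous_subspaceT/continuous_expRN_half.
- by move=> x _; exact: is_derive_expRN_half.
- rewrite -[X in _ --> X](mulr0 (- 2 * C)); apply: cvgMr; exact: expRN_half_cvgy.
- by apply: cvg_at_right_filter; exact: continuous_expRN_half.
Qed.

Lemma X1_density_integrable a r : 0 < a ->
  (@lebesgue_measure R).-integrable `[0, +oo[ (EFin \o X1_density a r).
Proof.
move=> a0; have [C hC] := X1_density_le r a0.
pose g x : R := C * expR (- (x / 2)).
have g0 (x : R) : 0 <= x -> 0 <= g x by move=> x0; rewrite (le_trans _ (hC x x0)).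
(* The bound [g] is integrable because it dominates itself and has an explicit primitive. *)
have [||||| ig _] := @expRN_half_FTC C g (fun x => - 2 * C * expR (- (x / 2))).
- by move=> x x0; rewrite ger0_norm // g0.
- exact/continuous_subspaceT/continuous_expRN_half.
- by move=> x _; exact: is_derive_expRN_half.
- rewrite -[X in _ --> X](mulr0 (- 2 * C)); apply: cvgMr; exact: expRN_half_cvgy.
- by apply: cvg_at_right_filter; exact: continuous_expRN_half.
apply: (le_integrable _ _ _ ig); first exact: measurable_itv.
  apply/measurable_EFinP; apply: subspace_continuous_measurable_fun.
    exact: measurable_itv.
  exact: X1_density_continuous.
by move=> x /=; rewrite in_itv /= andbT lee_fin => x0; rewrite [leRHS]ger0_norm ?g0 ?hC.
Qed.

(* The primitive is again of the form [X1_density a s], which vanishes at both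
   ends. *)
Lemma X1_density_primitive a r s : 0 < a ->
    (forall x, 0 < x ->
       s^`().[x] + s.[x] * (a / x - 1 - 2 / (x + a)) = r.[x]) ->
  \int[lebesgue_measure]_(x in `[0, +oo[) X1_density a r x = 0.
Proof.
move=> a0 sr; have [C hC] := X1_density_le r a0.
have [|||| _ ->] := @expRN_half_FTC C (X1_density a r) (X1_density a s) hC.
- exact: X1_density_continuous.
- by move=> x x0; have := is_derive_X1_density s a0 x0; rewrite sr.
- exact: X1_density_cvgy.
- exact: X1_density_cvg0.
by rewrite X1_density0 // oppr0.
Qed.

Lemma X1_innerE a p q : 0 < a ->
  X1_inner a p q = \int[lebesgue_measure]_(x in `[0, +oo[) X1_density a (p * q) x.
Proof.
move=> a0; rewrite -Rintegral_itv_obnd_cbnd; last first.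
  apply: integrableS (X1_density_integrable (p * q) a0).
  - exact: measurable_itv.
  - exact: measurable_itv.
  - by move=> x /=; rewrite !in_itv /= !andbT => /ltW.
rewrite /X1_inner set_itvoy; apply: eq_Rintegral => x _.
by rewrite /X1_density hornerM.
Qed.

Lemma X1_innerDl a p q r : 0 < a ->
  X1_inner a (p + q) r = X1_inner a p r + X1_inner a q r.
Proof.
move=> a0; rewrite !X1_innerE // -RintegralD; last 3 first.
- exact: measurable_itv.
- exact: X1_density_integrable.
- exact: X1_density_integrable.
by apply: eq_Rintegral => x _; rewrite /X1_density mulrDl hornerD mulrDl.
Qed.

Lemma X1_innerZl a c p r : 0 < a -> X1_inner a (c *: p) r = c * X1_inner a p r.
Proof.
move=> a0; rewrite !X1_innerE // -RintegralZl; last 2 first.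
- exact: measurable_itv.
- exact: X1_density_integrable.
apply: eq_Rintegral => x _; rewrite /X1_density -scalerAl hornerZ. by rewrite -mulrA.
Qed.

(** If the integral vanished, the nonnegative integrand would be 0 off a null set. Beyond the Cauchy
    bound [p] has no root, so that null set would contain an interval of length 1. *)
Lemma X1_inner_neq0 a p : 0 < a -> p != 0 -> X1_inner a p p != 0.
Proof.
move=> a0 p0; apply/eqP; rewrite X1_innerE // /Rintegral => I0.
have ip := X1_density_integrable (p * p) a0.
have dge0 x : 0 <= X1_density a (p * p) x.
  by rewrite /X1_density hornerM mulr_ge0 ?X1_weight_ge0 // -expr2 sqr_ge0.
have fin : (\int[lebesgue_measure]_(x in `[0%R,
  +oo[) (EFin \o X1_density a (p * p)) x)%E \is a fin_num.
  by apply: integrable_fin_num ip; exact: measurable_itv.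
have E : (\int[lebesgue_measure]_(x in `[0%R,
  +oo[) `|(EFin \o X1_density a (p * p)) x| = 0)%E.
  transitivity (\int[lebesgue_measure]_(x in `[0%R,
    +oo[) (EFin \o X1_density a (p * p)) x)%E.
    by apply: eq_integral => x _; rewrite /= ger0_norm.
  by rewrite -(fineK fin) I0.
have [A [mA A0 sA]] := (ae_eq_integral_abs lebesgue_measure (measurable_itv _)
  (measurable_int _ ip)).1 E.
pose M := cauchy_bound p.
have MA : `[M, M + 1]%classic `<=` A.
  move=> x /=; rewrite in_itv /= => /andP[Mx _]; apply: sA => /=.
  have x0 : 0 < x by apply: lt_le_trans Mx; exact: cauchy_bound_gt0.
  rewrite in_itv /= andbT => /(_ (ltW x0)) H.
  have px : p.[x] != 0 by apply: (ge_cauchy_bound p0); rewrite in_itv /= andbT.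
  have wx : X1_weight a x != 0 by rewrite gt_eqF // X1_weight_gt0.
  have /eqP := mulf_neq0 (mulf_neq0 px px) wx; rewrite -hornerM; apply.
  by case: H.
have : (lebesgue_measure (`[M, (M + 1)%R]%classic : set R) <= lebesgue_measure A)%E.
  by apply: le_measure => //; rewrite inE //; exact: measurable_itv.
by rewrite A0 lebesgue_measure_itv /= lte_fin ltrDl ltr01 -EFinD addrAC subrr add0r
  lee_fin ler10.
Qed.

End Weight.

(** * Identification with the Gram-Schmidt polynomials *)

Section GramSchmidt.
Variables (R : realType) (a : R).
Hypothesis a0 : 0 < a.
Implicit Types (m n : nat) (p : {poly R}).

(** The X_1-Laguerre equation, with eigenvalue [m], cleared of its denominator [x + a]. *)
Lemma exceptional_laguerre_ode m (p := exceptional_laguerre a m) :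
  ('X + a%:P) * 'X * p^`()^`()
  - ('X - a%:P) * (('X + a%:P + 1) * p^`() - p) + m%:R%:P * ('X + a%:P) * p = 0.
Proof.
have ode := laguerre_ode a m; rewrite {}/p /exceptional_laguerre.
set q := laguerre a m in ode *.
have ode' := congr1 (@deriv R) ode.
rewrite !(derivD, derivN, derivM, derivC, derivX, derivXsubC, polyCD,
  linear0) in ode' *.
move: ode ode'; set q1 := q^`(); set q2 := q1^`(); set q3 := q2^`() => ode ode'.
set s := 'X + a%:P.
(* The left side is a combination of the Laguerre equation and its derivative, with multipliers
   [s (1 + s)] and [- s^2]. *)
transitivity (s * (1 + s) * ('X * q2 + (a%:P - 'X) * q1 + m%:R%:P * q) -
  s * s * ('X * q3 + (1 + a%:P - 'X) * q2 + (m%:R%:P - 1) * q1)).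
  by rewrite /s; ring.
have -> : 'X * q3 + (1 + a%:P - 'X) * q2 + (m%:R%:P - 1) * q1 = 0.
  by rewrite -[RHS]ode'; ring.
by rewrite [X in _ * X - _]ode; ring.
Qed.

(** Lagrange's identity: the two differential equations make [(n - m) p q] times the weight the
    derivative of [x (p' q - p q')] times the weight. *)
Lemma X1_inner_exceptional_laguerre m n : m != n ->
  X1_inner a (exceptional_laguerre a m) (exceptional_laguerre a n) = 0.
Proof.
move=> mn; set p := exceptional_laguerre a m; set q := exceptional_laguerre a n.
have nm : (n%:R - m%:R : R) != 0 by rewrite subr_eq0 eqr_nat eq_sym.
apply: (mulfI nm); rewrite mulr0 -X1_innerZl // X1_innerE //.
apply: (X1_density_primitive (s := 'X * (p^`() * q - p * q^`()))) => // x x0.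
have xa : x + a != 0 by rewrite gt_eqF ?addr_gt0.
have xn : x != 0 by rewrite gt_eqF.
have ode k (r := exceptional_laguerre a k) : (r^`()^`()).[x] =
    ((x - a) * ((x + a + 1) * r^`().[x] - r.[x]) - k%:R * (x + a) * r.[x]) / (x *
      (x + a)).
  have := congr1 (horner^~ x) (exceptional_laguerre_ode k); rewrite -/r.
  rewrite !(hornerD, hornerM, hornerN, hornerC, hornerX) => E.
  apply: (mulIf (mulf_neq0 xn xa)); apply/eqP; rewrite -subr_eq0 -[X in _ == X]E.
  by apply/eqP; field; rewrite xa xn.
have := ode n; have := ode m; rewrite /= -/p -/q; clearbody p q => odep odeq.
rewrite !(derivD, derivN, derivM, derivX).
rewrite !(hornerD, hornerZ, hornerM, hornerN, hornerC, hornerX) odep odeq.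
by field; rewrite xa xn.
Qed.

(* This condition cuts out the span of [X1_basis a]. *)
Definition X1_space p := p.[- a] = p^`().[- a].

Lemma X1_spaceB c p q : X1_space p -> X1_space q -> X1_space (p - c *: q).
Proof.
by rewrite /X1_space derivB derivZ !(hornerD, hornerN, hornerZ) => -> ->.
Qed.

Lemma X1_space_exceptional_laguerre m : X1_space (exceptional_laguerre a m).
Proof.
rewrite /X1_space /exceptional_laguerre.
rewrite !(derivD, derivN, derivM, derivC, derivX).
rewrite !(hornerD, hornerM, hornerN, hornerC, hornerX); ring.
Qed.

Lemma X1_space_basis m : X1_space (X1_basis a m.+1).
Proof.
rewrite /X1_space /X1_basis; case: m => [|m] /=.
  rewrite derivD derivX derivC !(hornerD, hornerX, hornerC); ring.
rewrite deriv_exp derivD derivX derivC !(hornerMn, hornerM, horner_exp, hornerD,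
  hornerX, hornerC).
by rewrite addNr !expr0n /= ?(mulr0, mul0r, mul0rn).
Qed.

Lemma size_monic_X1_basis m :
  X1_basis a m.+1 \is monic /\ size (X1_basis a m.+1) = m.+2.
Proof.
rewrite /X1_basis -[a]opprK polyCN; case: m => [|m] /=.
  by rewrite -[_ + 1]opprK polyCN monicXsubC size_XsubC.
by rewrite monic_exp ?monicXsubC // size_exp_XsubC.
Qed.

(** Leading terms are removed one degree at a time. The process ends at a constant, and the only
    constant in the space is 0. *)
Lemma X1_space_expansion n p : X1_space p -> (size p <= n.+1)%N ->
  exists c : nat -> R, p = \sum_(i < n) c i *: exceptional_laguerre a i.
Proof.
elim: n p => [|n ih] p Up sp.
  exists (fun=> 0); rewrite big_ord0; move: Up.
  by rewrite [p]size1_polyC // /X1_space derivC !hornerC => ->; rewrite polyC0.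
pose d := p`_n.+1.
have [] := ih (p - d *: exceptional_laguerre a n).
- by apply: X1_spaceB Up _; exact: X1_space_exceptional_laguerre.
- apply/leq_sizeP => j; rewrite leq_eqVlt => /orP[/eqP<-|nj]; rewrite coefB coefZ.
    have := monic_exceptional_laguerre a n;
      rewrite monicE lead_coefE size_exceptional_laguerre.
    by move=> /eqP /= ->; rewrite mulr1 subrr.
  rewrite !nth_default ?size_exceptional_laguerre ?mulr0 ?subr0 //.
  exact: leq_trans sp _.
move=> c E; exists (fun i => if (i < n)%N then c i else d).
rewrite big_ord_recr /= ltnn; under eq_bigr do rewrite ltn_ord.
by rewrite -E subrK.
Qed.

(** Both polynomials are monic of the same degree, so their difference lies in the space with
    smaller degree. *)
Lemma X1_basis_expansion m : exists c : nat -> R, X1_basis a m.+1 =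
  exceptional_laguerre a m + \sum_(i < m) c i *: exceptional_laguerre a i.
Proof.
have [mon sz] := size_monic_X1_basis m.
have [||c E] := @X1_space_expansion m (X1_basis a m.+1 - exceptional_laguerre a m).
- rewrite -[X in _ - X]scale1r.
  by apply: X1_spaceB; [exact: X1_space_basis|exact: X1_space_exceptional_laguerre].
- apply/leq_sizeP => j; rewrite leq_eqVlt coefB => /orP[/eqP<-|mj].
    have := monic_exceptional_laguerre a m;
      rewrite monicE lead_coefE size_exceptional_laguerre.
    move: mon; rewrite monicE lead_coefE sz => /eqP /= -> /eqP /= ->.
    by rewrite subrr.
  by rewrite !nth_default ?sz ?size_exceptional_laguerre ?subr0.
by exists c; rewrite -E addrC subrK.
Qed.

Lemma X1_inner_suml (I : finType) (F : I -> {poly R}) p :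
  X1_inner a (\sum_i F i) p = \sum_i X1_inner a (F i) p.
Proof.
elim/big_ind2: _ => // [|u v w z <- <-]; last by rewrite X1_innerDl.
by rewrite -[0](scale0r 0) X1_innerZl // mul0r.
Qed.

(** By orthogonality, projecting the next basis element on the earlier outputs recovers the
    coefficients of its expansion; subtracting these projections leaves the monic leading term of
    the expansion. *)
Lemma gram_schmidt_X1_basis n :
  gram_schmidt (X1_inner a) (X1_basis a) n = mkseq (exceptional_laguerre a) n.
Proof.
elim: n => [|n ih] //; rewrite [LHS]/= ih.
have -> : mkseq (exceptional_laguerre a) n.+1 =
    rcons (mkseq (exceptional_laguerre a) n) (exceptional_laguerre a n).
  by rewrite /mkseq -addn1 iotaD map_cat cats1.
congr rcons; have [c E] := X1_basis_expansion n.
rewrite big_map -[iota 0 n](_ : index_iota 0 n = _) ?big_mkord; last first.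
  by rewrite /index_iota subn0.
apply/eqP; rewrite subr_eq {1}E; apply/eqP; congr (_ + _).
apply: eq_bigr => i _; congr (_ *: _).
have nz := X1_inner_neq0 a0 (exceptional_laguerre_neq0 a i).
apply: (mulIf nz); rewrite divfK // E (X1_innerDl (exceptional_laguerre a n)) //
  (@X1_inner_exceptional_laguerre n i); last first.
  by rewrite neq_ltn ltn_ord orbT.
rewrite add0r X1_inner_suml (bigD1 i) //= X1_innerZl // big1 ?addr0 // => j ji.
by rewrite X1_innerZl // X1_inner_exceptional_laguerre ?mulr0.
Qed.

Lemma X1_LaguerreE n : X1_Laguerre a n.+1 = exceptional_laguerre a n.
Proof.
rewrite /X1_Laguerre gram_schmidt_X1_basis (last_nth 0) size_mkseq.
by rewrite -[nth _ _ _]/(nth 0 (mkseq _ _) n) nth_mkseq.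
Qed.

(** The shift by 2 skips the exceptional zero and passes from numbering from 1 to numbering from
    0. *)
Lemma X1_zeroE n k : (2 <= k <= n)%N ->
  X1_zero a n k = regular_zero a n.-1 (k - 2).
Proof.
case: n => [|n]; first by case: k => [|[|[]]].
case: k => [|[|k]] // _.
by rewrite /X1_zero X1_LaguerreE /regular_zero !subSS subn0.
Qed.

End GramSchmidt.

Theorem theorem2 (R : realType) :
  (forall n k : nat, (2 <= n)%N -> (2 <= k <= n)%N ->
     forall a b : R, 0 < a -> a < b -> X1_zero a n k < X1_zero b n k) /\
  (forall (a : R) (n : nat), 0 < a -> (2 <= n)%N ->
     0 < X1_zero a n.+1 2 /\
     forall k : nat, (2 <= k <= n)%N ->
       X1_zero a n.+1 k < X1_zero a n k < X1_zero a n.+1 k.+1).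
Proof.
split=> [n k n2 k2 a b a0 ab|a n a0 n2].
  rewrite !X1_zeroE //; last exact: lt_trans ab.
  by apply: regular_zero_increasing => //; lia.
split=> [|k k2]; first by rewrite X1_zeroE ?regular_zero_gt0 //; lia.
rewrite !X1_zeroE; try lia.
case: n k n2 k2 => [|n] [|[|k]] //= _; rewrite !ltnS !subSS !subn0 => k2.
by rewrite regular_zero_interlace_left // regular_zero_interlace_right.
Qed.
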